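(* Let $\mathcal{A}$ be an $n$-dimensional arrangement of $m$ hyperplanes of rank $r=r(\mathcal{A})$, with characteristic polynomial \[ \chi(\mathcal{A};t)=a_0t^n-a_1t^{n-1}+a_2t^{n-2}+\cdots+(-1)^ra_rt^{n-r}. \] Then \[ (-1)^k\sum_{i=0}^{k}\binom{r-i}{k-i}(-1)^ia_{i}\ge 0\qquad\text{for } 0\le k\le r. \]
   Context: An $n$-dimensional hyperplane arrangement $\mathcal{A}$ is a finite set of (affine, not necessarily through the origin) hyperplanes in an $n$-dimensional vector space $V$. The intersection semi-lattice $L(\mathcal{A})$ is the set of all nonempty intersections $\bigcap_{H\in\mathcal{B}}H$ with $\mathcal{B}\subseteq\mathcal{A}$, including $V=\bigcap_{H\in\emptyset}H$, partially ordered by reverse inclusion; its minimal element is $\hat 0=V$. The rank $r(\mathcal{A})$ is the maximal rank of $L(\mathcal{A})$, equivalently the dimension of the span of the normal vectors of the hyperplanes in $\mathcal{A}$. The characteristic polynomial is $\chi(\mathcal{A};t)=\sum_{X\in L(\mathcal{A})}\mu(\hat 0,X)\,t^{\dim X}$, where $\mu$ is the Möbius function of $L(\mathcal{A})$. *)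

(* Defs.v *)
From HB Require Import structures.
From mathcomp Require Import all_boot all_order all_algebra.
From mathcomp Require Import finmap.
From mathcomp Require Import boolp classical_sets.

Set Implicit Arguments.
Unset Strict Implicit.
Unset Printing Implicit Defensive.

Import Order.TTheory GRing.Theory Num.Theory.

Local Open Scope fset_scope.
Local Open Scope classical_set_scope.
Local Open Scope order_scope.
Local Open Scope ring_scope.

Section FinitePoset.
Context {d : Order.disp_t} {P : finPOrderType d}.
Implicit Types (x y z : P) (C : {set P}).

(* The first argument is fuel; [mobiusE] below shows that #|P| is enough. *)
Fixpoint mobius_rec (n : nat) x y : int :=
  if n is n'.+1 then
    if x == y then 1
    else if (x < y)%O then
      - \sum_(z : P | (x <= z)%O && (z < y)%O) mobius_rec n' x z
    else 0
  else 0.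

Definition mobius x y : int := mobius_rec #|P| x y.

Lemma mobius_rec_stable n m x y :
  (#|[pred z | (z <= y)%O]| <= n)%N -> (#|[pred z | (z <= y)%O]| <= m)%N ->
  mobius_rec n x y = mobius_rec m x y.
Proof.
have pos (t : P) : (0 < #|[pred z | (z <= t)%O]|)%N.
  by apply/card_gt0P; exists t; rewrite inE.
elim: n m y => [|n IHn] [|m] y len lem //=.
- by have := leq_trans (pos y) len.
- by have := leq_trans (pos y) lem.
case: eqP => // _; case: ifP => // _; congr (- _).
apply: eq_bigr => z /andP[_ zy].
have lt : (#|[pred t | (t <= z)%O]| < #|[pred t | (t <= y)%O]|)%N.
  apply: proper_card; apply/properP; split.
    by apply/fintype.subsetP => t; rewrite !inE => tz; apply: le_trans tz (ltW zy).
  by exists y; rewrite !inE // lt_geF.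
by apply: IHn; rewrite -ltnS; apply: leq_trans lt _.
Qed.

Lemma mobiusE x y :
  mobius x y =
    if x == y then 1
    else if (x < y)%O then
      - \sum_(z : P | (x <= z)%O && (z < y)%O) mobius x z
    else 0.
Proof.
rewrite {1}/mobius (@mobius_rec_stable _ #|P|.+1) //=; try exact: max_card.
exact: leq_trans (max_card _) (leqnSn _).
Qed.

Definition chain C := [forall x in C, forall y in C, (x >=< y)%O].

(* A chain with l + 1 elements has length l. *)
Definition poset_rank x : nat :=
  (\max_(C : {set P} | chain C && (C \subset [pred z | (z <= x)%O])) #|C|.-1)%N.

End FinitePoset.

Fact Lposet_display : Order.disp_t.
Proof. exact: Order.Disp tt tt. Qed.

Section Arrangement.
Context {F : fieldType} {V : vectType F}.
Implicit Types (A : {fset set V}) (U : {vspace V}).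

Definition affine_hyperplane (H : set V) : Prop :=
  exists (f : 'Hom(V, F^o)) (b : F), f != 0 /\ H = [set v | f v = b].

Definition is_arrangement A : Prop := forall H, H \in A -> affine_hyperplane H.

(* The linear subspace U with X = x + U; a junk value if X is not an affine
   subspace, which does not happen for the flats of an arrangement. *)
Definition direction (X : set V) : {vspace V} :=
  xget 0%VS [set U : {vspace V} | exists x : V, X = [set v | v - x \in U]].

Definition affine_dim (X : set V) : nat := \dim (direction X).

Lemma affine_dimE (X : set V) x U : X = [set v | v - x \in U] -> affine_dim X = \dim U.
Proof.
rewrite /affine_dim /direction => XE; case: xgetP => [W _ [y XE']|/(_ U)]; last first.
  by case; exists x.
have mem v : (v - x \in U) = (v - y \in W).
  by apply/idP/idP; move: XE'; rewrite XE => /(congr1 (@^~ v)) /= ->.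
have yxW : x - y \in W by rewrite -mem subrr mem0v.
congr (\dim _); apply/vspaceP => u.
by rewrite -[u in RHS](addrK x) mem -addrA rpredDr.
Qed.

(* The semilattice: nonempty intersections of subfamilies B of A; the empty
   subfamily gives the whole space. *)
Definition flats A : {fset set V} :=
  [fset X in [fset \bigcap_(H in [set` B]) H | B : {fset set V} in fpowerset A] |
    `[< X !=set0 >]].

Lemma flatsP A (X : set V) :
  (X \in flats A) <->
  exists B : {fset set V},
    [/\ (B `<=` A)%fset, X = \bigcap_(H in [set` B]) H & X !=set0].
Proof.
rewrite !inE; split.
  case/andP=> /imfsetP[B /= BA ->] /asboolP X0; exists B; split=> //.
  by rewrite -fpowersetE.
case=> B [BA XE X0]; apply/andP; split; last exact/asboolP.
by apply/imfsetP; exists B => //=; rewrite fpowersetE.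
Qed.

Definition Lposet A : Type := flats A.

HB.instance Definition _ A := Finite.on (Lposet A).

Section Order.
Variable A : {fset set V}.
Implicit Types X Y Z : Lposet A.

Definition Lposet_le X Y : bool := `[< val Y `<=` val X >].

Lemma Lposet_le_refl : reflexive Lposet_le.
Proof. by move=> X; apply/asboolP. Qed.

Lemma Lposet_le_anti : antisymmetric Lposet_le.
Proof.
by move=> X Y /andP[/asboolP YX /asboolP XY]; apply/val_inj/seteqP; split.
Qed.

Lemma Lposet_le_trans : transitive Lposet_le.
Proof.
move=> Y X Z /asboolP YX /asboolP ZY; apply/asboolP.
exact: subset_trans ZY YX.
Qed.

HB.instance Definition _ :=
  Order.Le_isPOrder.Build Lposet_display (Lposet A)
    Lposet_le_refl Lposet_le_anti Lposet_le_trans.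

Lemma setT_flat : [set: V] \in flats A.
Proof.
rewrite !inE; apply/andP; split; last by apply/asboolP; exists 0.
apply/imfsetP; exists fset0; first by rewrite /= fpowersetE fsub0set.
by apply/seteqP; split.
Qed.

Definition Lposet_bot : Lposet A := [` setT_flat ].

Lemma Lposet_bot_le X : (Lposet_bot <= X)%O.
Proof. by apply/asboolP. Qed.

HB.instance Definition _ :=
  Order.hasBottom.Build Lposet_display (Lposet A) Lposet_bot_le.

End Order.

Definition arrangement_rank A : nat := (\max_(X : Lposet A) poset_rank X)%N.

Definition arrangement_charpoly A : {poly int} :=
  \sum_(X : Lposet A) mobius (\bot : Lposet A)%O X *: 'X^(affine_dim (val X)).

End Arrangement.

(* Main.v *)
Require Import Defs.
From mathcomp Require Import all_boot all_order all_algebra.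
From mathcomp Require Import finmap.
From mathcomp Require Import boolp classical_sets.

Set Implicit Arguments.
Unset Strict Implicit.
Unset Printing Implicit Defensive.

Import Order.TTheory GRing.Theory Num.Theory.
Local Open Scope ring_scope.

(** Write chi(t) = t^(n-r) p(t). The sum in question is the coefficient of
    t^(r-k) in p(1+t), so the claim is that (-1)^r p(1-t) has nonnegative
    coefficients; for a central arrangement this polynomial is T(t,0), with T
    the Tutte polynomial.

    By Whitney's theorem chi is the sum of (-1)^|B| t^(dim of the flat of B)
    over the subfamilies B with nonempty intersection. Homogenizing, a
    hyperplane becomes a covector in F^(n+1), and B has nonempty intersection
    iff the span of its covectors avoids the covector e at infinity, in which
    case the flat has dimension n - dim(span). The same sum makes sense for any
    subspace U and list of covectors s, summing over the spans U + <B> with B a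
    sublist of s. In this form restriction to a hyperplane h is the replacement
    of U by U + <h>, and nonnegativity follows by deletion-restriction, by
    induction on s: a loop gives 0, a covector parallel to U can be deleted, a
    coloop multiplies by t - 1, and in the remaining case the two terms have
    the same rank and their signs agree. *)

(** * Deletion-restriction for covectors *)

Section RowSpace.
Context {F : fieldType} {N : nat}.
Implicit Types (U W : 'M[F]_N) (h e : 'rV[F]_N) (s : seq 'rV[F]_N).

Lemma mxrank_adjoin U h : ~~ (h <= U)%MS -> \rank (U + h)%MS = (\rank U).+1.
Proof.
move=> hU; apply/eqP; rewrite eqn_leq; apply/andP; split.
  apply: leq_trans (mxrank_adds_leqif U h) _.
  by rewrite -[leqRHS]addn1 leq_add2l rank_leq_row.
apply: rank_ltmx; rewrite ltmxE addsmxSl /=.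
by apply: contra hU; apply: submx_trans; apply: addsmxSr.
Qed.

(** [U + e] lies in [U + h], and both have rank one more than [U], so they coincide. *)
Lemma submx_exchange U h e :
  ~~ (e <= U)%MS -> (e <= U + h)%MS -> (h <= U + e)%MS.
Proof.
move=> eU eUh.
have hU : ~~ (h <= U)%MS.
  by apply: contra eU => hU; apply: submx_trans eUh _; rewrite addsmx_sub submx_refl.
have sub : (U + e <= U + h)%MS by rewrite addsmx_sub addsmxSl.
apply: submx_trans (addsmxSr U h) _.
by rewrite -(geq_leqif (mxrank_leqif_sup sub)) !mxrank_adjoin.
Qed.

Definition adjoin U s : 'M[F]_N := foldr (fun h W => (W + h)%MS) U s.

Lemma adjoin_subP U s W :
  reflect ((U <= W)%MS /\ forall h, h \in s -> (h <= W)%MS) (adjoin U s <= W)%MS.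
Proof.
elim: s => [|h s IHs] /=; first by apply: (iffP idP) => [|[]//]; split.
rewrite addsmx_sub; apply: (iffP andP) => [[/IHs[UW sW] hW]|[UW sW]].
  by split=> // g; rewrite inE => /predU1P[->|/sW].
split; last by apply: sW; rewrite mem_head.
by apply/IHs; split=> // g gs; apply: sW; rewrite inE gs orbT.
Qed.

Lemma sub_adjoin U s : (U <= adjoin U s)%MS.
Proof. by have /adjoin_subP[] := submx_refl (adjoin U s). Qed.

Lemma mem_adjoin U s h : h \in s -> (h <= adjoin U s)%MS.
Proof. by have /adjoin_subP[_] := submx_refl (adjoin U s); apply. Qed.

Lemma adjoin_cons U h s : (adjoin (U + h)%MS s :=: adjoin U (h :: s))%MS.
Proof.
apply/eqmxP/andP; split; last first.
  rewrite /= addsmx_sub; apply/andP; split.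
    apply/adjoin_subP; split; last by move=> g; apply: mem_adjoin.
    exact: submx_trans (addsmxSl _ _) (sub_adjoin _ _).
  exact: submx_trans (addsmxSr _ _) (sub_adjoin _ _).
apply/adjoin_subP; split.
  by rewrite addsmx_sub sub_adjoin mem_adjoin ?mem_head.
by move=> g gs; rewrite mem_adjoin // inE gs orbT.
Qed.

End RowSpace.

Lemma eq_adjoin (F : fieldType) (N : nat) (U : 'M[F]_N) s t :
  s =i t -> (adjoin U s :=: adjoin U t)%MS.
Proof.
move=> st; apply/eqmxP/andP; split; apply/adjoin_subP; split;
  try exact: sub_adjoin; by move=> h hs; apply: mem_adjoin; rewrite ?st // -st.
Qed.

Lemma adjoin_fset1U (F : fieldType) (N : nat) (K : choiceType)
    (w : K -> 'rV[F]_N) (U : 'M[F]_N) x (B : {fset K}) :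
  (adjoin U [seq w y | y <- (x |` B)%fset] :=: adjoin U [seq w y | y <- B] + w x)%MS.
Proof.
apply: (@eq_adjoin _ _ _ _ (w x :: [seq w y | y <- B])) => h; rewrite inE.
apply/mapP/idP => [[y]|].
  by rewrite in_fset1U => /predU1P[->|yB] ->; rewrite ?eqxx // map_f ?orbT.
case/predU1P => [->|/mapP[y yB ->]]; [exists x|exists y] => //.
  exact: fset1U1.
exact: fset1Ur.
Qed.

Section WhitneyPoly.
Context {F : fieldType} {n : nat} (e : 'rV[F]_n.+1).
Implicit Types (U W : 'M[F]_n.+1) (h : 'rV[F]_n.+1) (s : seq 'rV[F]_n.+1).

(** In the application the rows of [U] are affine equations and [e] is the inconsistent equation 1 =
    0; a consistent system cuts out a flat of dimension [n - \rank U]. *)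
Definition whitney_term U : {poly int} :=
  if (e <= U)%MS then 0 else 'X^(n - \rank U).

(* This is the sum of [(-1)^|B| * whitney_term (U + <B>)] over sublists B of s,
   organised so that deletion-restriction holds by definition. *)
Fixpoint whitney_poly U s : {poly int} :=
  if s is h :: s' then whitney_poly U s' - whitney_poly (U + h)%MS s'
  else whitney_term U.

Lemma eq_whitney_term U W : (U :=: W)%MS -> whitney_term U = whitney_term W.
Proof. by move=> UW; rewrite /whitney_term !UW. Qed.

Lemma eq_whitney_poly U W s :
  (U :=: W)%MS -> whitney_poly U s = whitney_poly W s.
Proof.
elim: s U W => [|h s IHs] U W UW /=; first exact: eq_whitney_term.
by congr (_ - _); apply: IHs => //; apply: adds_eqmx.
Qed.

Lemma whitney_poly_eq0 U s : (e <= U)%MS -> whitney_poly U s = 0.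
Proof.
elim: s U => [|h s IHs] U eU /=; first by rewrite /whitney_term eU.
by rewrite !IHs ?subr0 // (submx_trans eU) ?addsmxSl.
Qed.

(** Adding [h] to any span in the sum neither brings in [e] nor fails to raise the rank by one, so
    each nonzero term loses exactly one factor ['X]. *)
Lemma whitney_poly_coloop U h s : ~~ (h <= adjoin U s + e)%MS ->
  whitney_poly U s = 'X * whitney_poly (U + h)%MS s.
Proof.
elim: s U => [|g s IHs] U hU /=.
  rewrite /whitney_term; case: ifPn => eU.
    by rewrite (submx_trans eU) ?addsmxSl ?mulr0.
  have eUh : ~~ (e <= U + h)%MS by apply: contra hU; apply: submx_exchange.
  have hU' : ~~ (h <= U)%MS.
    by apply: contra hU => hU; apply: submx_trans hU (addsmxSl _ _).
  (* This gives [\rank U + 2 <= n + 1], so the truncated [n - \rank U] is really a successor. *)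
  have := rank_leq_col (U + h + e)%MS.
  rewrite (negPf eUh) !mxrank_adjoin // !ltnS => lt.
  by rewrite -exprS -subSn // subSS.
rewrite mulrBr -!IHs.
- congr (_ - _).
  have E : (U + h + g :=: U + g + h)%MS.
    by rewrite -!addsmxA; apply: adds_eqmx => //; rewrite addsmxC.
  rewrite (eq_whitney_poly _ E) -IHs //.
  apply: contra hU => hU; apply: submx_trans hU _.
  by apply: addsmxS => //; rewrite adjoin_cons.
- apply: contra hU => hU; apply: submx_trans hU _.
  by apply: addsmxS => //; apply: addsmxSl.
Qed.

(* Joining e makes constant terms irrelevant and accounts for one dimension, so
   this is the rank of the linear parts of the covectors. *)
Definition affine_rank U s : nat := (\rank (adjoin U s + e)%MS).-1.

Lemma affine_rankE U s :
  e != 0 -> (affine_rank U s).+1 = \rank (adjoin U s + e)%MS.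
Proof.
move=> e0; rewrite prednK // lt0n mxrank_eq0; apply: contraNneq e0 => E.
by rewrite -submx0 -E addsmxSr.
Qed.

(** Expanding in powers of [1 - 'X] puts the sign claim into the coefficients of [c]; this form
    survives the sums and the factors [1 - 'X] that the recursion produces. *)
Lemma whitney_poly_sign U s : ~~ (e <= U)%MS ->
  exists2 c : {poly int}, forall i, 0 <= c`_i &
    whitney_poly U s =
    (-1) ^+ (affine_rank U s - \rank U) * 'X^(n - affine_rank U s) * (c \Po (1 - 'X)).
Proof.
elim: s U => [|h s IHs] U eU /=.
  exists 1; first by move=> i; rewrite coef1; case: eqP.
  rewrite /whitney_term (negPf eU) /affine_rank /= mxrank_adjoin //= subnn mul1r.
  by rewrite comp_polyC mulr1.
have [hU|hU] := boolP (h <= U)%MS.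
  exists 0; first by move=> i; rewrite coef0.
  rewrite comp_poly0 mulr0 (eq_whitney_poly s (W := U)) ?subrr //.
  exact/addsmx_idPl.
have [hUe|hUe] := boolP (h <= U + e)%MS.
  have [c c0 ->] := IHs _ eU; exists c => //.
  rewrite [whitney_poly (U + h)%MS s]whitney_poly_eq0 ?subr0; last exact: submx_exchange.
  suff -> : affine_rank U (h :: s) = affine_rank U s by [].
  congr (_.-1); apply: eqmx_rank; apply/andP; split; last first.
    by apply: addsmxS => //; apply: addsmxSl.
  rewrite !addsmx_sub addsmxSl addsmxSr andbT /=.
  by apply: submx_trans hUe _; apply: addsmxS => //; apply: sub_adjoin.
have eUh : ~~ (e <= U + h)%MS by apply: contra hUe; apply: submx_exchange.
have [c2 c2_ge0 Q2] := IHs _ eUh.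
have EA : affine_rank (U + h)%MS s = affine_rank U (h :: s).
  by rewrite /affine_rank (adds_eqmx (adjoin_cons U h s) (eqmx_refl e)).
(* Strictness makes the truncated exponent drop by exactly one when [h] joins [U], so restriction
   flips the sign. *)
have rlt : (\rank U < affine_rank U (h :: s))%N.
  have e0 : e != 0 by apply: contraNneq eU => ->; rewrite sub0mx.
  rewrite -EA -ltnS affine_rankE // -(mxrank_adjoin hU) -(mxrank_adjoin eUh).
  by apply: mxrankS; apply: addsmxS => //; apply: sub_adjoin.
rewrite EA mxrank_adjoin // in Q2.
have sgE : (-1) ^+ (affine_rank U (h :: s) - \rank U) =
    - (-1) ^+ (affine_rank U (h :: s) - (\rank U).+1) :> {poly int}.
  by rewrite -(subnSK rlt) exprS mulN1r.
have [hS|hS] := boolP (h <= adjoin U s + e)%MS.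
  have [c1 c1_ge0 Q1] := IHs _ eU.
  have E1 : affine_rank U s = affine_rank U (h :: s).
    congr (_.-1); apply: eqmx_rank; apply/andP; split.
      by apply: addsmxS => //; apply: addsmxSl.
    by rewrite !addsmx_sub addsmxSl addsmxSr hS.
  exists (c1 + c2); first by move=> i; rewrite coefD addr_ge0.
  by rewrite Q1 Q2 E1 comp_polyD mulrDr sgE !mulNr.
(* The difference is ['X - 1] times the restricted polynomial, and [1 - 'X] is ['X] composed with
   [1 - 'X]. *)
exists ('X * c2); first by move=> i; rewrite coefXM; case: ifP.
rewrite (whitney_poly_coloop hS) Q2 comp_polyM comp_polyX sgE !mulNr.
by rewrite mulrCA mulrBl mul1r mulrBr opprB.
Qed.
End WhitneyPoly.

(** * Sums over subfamilies and the Moebius function *)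

Section PowersetSums.
Local Open Scope fset_scope.
Context {K : choiceType}.
Implicit Types (A B : {fset K}) (x : K).

Lemma big_fpowerset1U (R : nmodType) x A (g : {fset K} -> R) : x \notin A ->
  (\sum_(B <- fpowerset (x |` A)) g B =
   \sum_(B <- fpowerset A) g B + \sum_(B <- fpowerset A) g (x |` B)%fset)%R.
Proof.
move=> xA; rewrite -(big_map (fun B => x |` B) xpredT g) -big_cat.
have xB B : B \in fpowerset A -> x \notin B.
  by rewrite fpowersetE => /fsubsetP BA; apply: contra xA; apply: BA.
apply: perm_big; apply: uniq_perm; first exact: fset_uniq.
  rewrite cat_uniq fset_uniq /= map_inj_in_uniq ?fset_uniq ?andbT.
    apply/hasPn => _ /mapP[B _ ->]; apply: contraL (fset1U1 x B) => /xB //.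
  by move=> B C /xB xB' /xB xC E; rewrite -(fsetU1K xB') E fsetU1K.
move=> B; rewrite mem_cat fpowersetE; apply/idP/orP => [BA|].
  have [xB'|xB'] := boolP (x \in B); last first.
    by left; rewrite fpowersetE -(mem_fsetD1 xB') fsubDset.
  right; apply/mapP; exists (B `\ x); last by rewrite fsetD1K.
  by rewrite fpowersetE fsubDset.
case=> [|/mapP[C CA ->]].
  by rewrite fpowersetE => BA; apply: fsubset_trans BA (fsubsetU1 _ _).
by apply: fsetUS; rewrite -fpowersetE.
Qed.

(** Toggling a fixed element of [A] pairs subfamilies of opposite sign. *)
Lemma sum_sign_fpowerset (R : pzRingType) A :
  \sum_(B <- fpowerset A) (-1) ^+ #|` B| = (A == fset0)%:R :> R.
Proof.
have [->|[x xA]] := fset_0Vmem A.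
  by rewrite fpowerset0 big_seq_fset1 cardfs0 eqxx.
rewrite -(fsetD1K xA) big_fpowerset1U ?fsetD11 //.
rewrite -big_split /= big_seq big1 => [|B].
  by case: eqP => // /fsetP/(_ x); rewrite fset1U1 inE.
rewrite fpowersetE => /fsubsetP BA.
have xB : x \notin B by apply/negP => /BA; rewrite fsetD11.
by rewrite cardfsU1 xB exprS mulN1r addrN.
Qed.

End PowersetSums.

(** Each step of the recursion splits the subfamilies by whether they contain the first index. They
    are families of indices, so [w] may repeat covectors. *)
Lemma whitney_poly_sum (F : fieldType) (n : nat) (e : 'rV[F]_n.+1)
    (K : choiceType) (w : K -> 'rV[F]_n.+1) U (s : seq K) (A : {fset K}) :
  uniq s -> A =i s ->
  whitney_poly e U [seq w x | x <- s] =
  \sum_(B <- fpowerset A)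
    (-1) ^+ #|` B|%fset * whitney_term e (adjoin U [seq w x | x <- B]).
Proof.
elim: s U A => [|h s IHs] U A /=.
  move=> _ A0; have -> : A = fset0 by apply/fsetP => x; rewrite A0.
  by rewrite fpowerset0 big_seq_fset1 cardfs0 mul1r.
case/andP=> hs us As; set C := [fset x in s]%fset.
have -> : A = (h |` C)%fset by apply/fsetP => x; rewrite As !inE.
have Cs : C =i s by move=> x; rewrite inE.
rewrite big_fpowerset1U ?Cs // !(IHs _ C) // -sumrN; congr (_ + _).
apply: eq_big_seq => B; rewrite fpowersetE => /fsubsetP BC.
have hB : h \notin B by apply: contra hs => /BC; rewrite Cs.
rewrite cardfsU1 hB exprS mulN1r mulNr; congr (- (_ * _)).
apply: eq_whitney_term; apply: eqmx_trans (adjoin_cons _ _ _) _.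
exact/eqmx_sym/adjoin_fset1U.
Qed.

(** Solving the hypothesis for [nu x] gives the recursion of [mobius]; the induction is on the
    number of elements below [x]. *)
Lemma mobius_unique (d : Order.disp_t) (P : finBPOrderType d) (nu : P -> int) :
  (forall x, \sum_(z : P | (z <= x)%O) nu z = (x == \bot%O)%:R) ->
  forall x, mobius \bot%O x = nu x.
Proof.
move=> nuE x; have [k] := ubnP #|[pred z : P | (z <= x)%O]|.
elim: k x => // k IHk x; rewrite ltnS => lek; rewrite mobiusE.
have := nuE x; rewrite (bigD1 x) //= [\bot%O == x]eq_sym.
have [-> |x0] := eqVneq.
  rewrite big1 ?addr0 // => z /andP[]; rewrite lex0 => /eqP->.
  by rewrite eqxx.
move=> /eqP; rewrite addr_eq0 => /eqP ->.
rewrite lt0x x0; congr (- _).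
apply: eq_big => [z|z /andP[_ zx]]; first by rewrite le0x lt_neqAle andTb andbC.
apply: IHk; apply: leq_trans lek; apply: proper_card; apply/properP; split.
  by apply/fintype.subsetP => t; rewrite !inE => tz; apply: le_trans tz (ltW zx).
by exists x; rewrite !inE // lt_geF.
Qed.

(** * Affine hyperplanes as covectors *)

Section Homogenization.
Import VectorInternalTheory.
Local Open Scope classical_set_scope.
Context {F : fieldType} {V : vectType F}.
Let d := dim V.

(** Embedding at height one: affine functions on [V] become linear forms, with the constant term as
    first coordinate. *)
Definition homogenize (v : V) : 'rV[F]_(1 + d) := row_mx 1%:M (v2r v).

(** The constant function 1, which has no zeros. *)
Definition infinity_covector : 'rV[F]_(1 + d) := row_mx 1%:M 0.

Lemma infinity_covector0 : ~~ (infinity_covector <= (0 : 'M_(1 + d)))%MS.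
Proof.
rewrite submx0; apply/eqP => /(congr1 (fun M => lsubmx M 0 0)).
by rewrite row_mxKl !mxE; apply/eqP/oner_neq0.
Qed.

Definition affine_zeros k (M : 'M[F]_(k, 1 + d)) : set V :=
  [set v | (M <= kermx (homogenize v)^T)%MS].

Lemma affine_zerosS k l (M : 'M[F]_(k, 1 + d)) (L : 'M[F]_(l, 1 + d)) :
  (M <= L)%MS -> affine_zeros L `<=` affine_zeros M.
Proof. by move=> ML v; apply: submx_trans. Qed.

Lemma affine_zerosE k (M : 'M[F]_(k, 1 + d)) v :
  affine_zeros M v <-> lsubmx M + rsubmx M *m (v2r v)^T = 0.
Proof.
rewrite /affine_zeros /homogenize /= -{1}[M]hsubmxK tr_row_mx trmx1.
by rewrite (sameP sub_kermxP eqP) mul_row_col mulmx1; split=> /eqP.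
Qed.

(** The covector at infinity pairs to 1 with every [homogenize v], so a consistent system cannot
    imply it. Conversely, being outside the row space is detected by a column of the cokernel. *)
Lemma affine_zeros_neq0 k (M : 'M[F]_(k, 1 + d)) :
  affine_zeros M !=set0 <-> ~~ (infinity_covector <= M)%MS.
Proof.
split=> [[v vM]|].
  apply/negP => /submx_trans/(_ vM)/sub_kermxP/eqP.
  by rewrite tr_row_mx mul_row_col mul0mx addr0 trmx1 mulmx1 oner_eq0.
rewrite submxE => /matrix0Pn[i [j]]; rewrite ord1 {i}.
set y := col j (cokermx M) => ne0.
have My : M *m y = 0 by rewrite /y colE mulmxA mulmx_coker mul0mx.
have yE : (infinity_covector *m cokermx M) 0 j = (usubmx y) 0 0.
  have -> : (infinity_covector *m cokermx M) 0 j = (infinity_covector *m y) 0 0.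
    by rewrite /y colE mulmxA -colE [in RHS]mxE.
  by rewrite -[y in LHS]vsubmxK mul_row_col mul1mx mul0mx addr0.
rewrite yE in ne0; set c := usubmx y 0 0 in ne0.
have uE : usubmx y = c%:M by rewrite [LHS]mx11_scalar.
(* [M] kills [y], whose first coordinate [c] is nonzero; scaling by [c^-1] brings it to height
   one. *)
exists (@r2v F V (c^-1 *: (dsubmx y)^T)); apply/affine_zerosE.
rewrite r2vK linearZ /= trmxK -scalemxAr.
apply: (scalerI ne0); rewrite scaler0 scalerDr scalerA divff // scale1r.
have := My; rewrite -[M]hsubmxK -[y]vsubmxK mul_row_col => <-.
by rewrite row_mxKl row_mxKr col_mxKd uE mul_mx_scalar.
Qed.

(** The zero set is a translate of the kernel of the linear part [R]. A common zero [x] makes the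
    constant column a combination of the columns of [R], so [R] and [M] have the same rank. *)
Lemma affine_dim_zeros k (M : 'M[F]_(k, 1 + d)) :
  affine_zeros M !=set0 -> affine_dim (affine_zeros M) = (d - \rank M)%N.
Proof.
case=> x xM; set R := rsubmx M.
have xE : lsubmx M = - (R *m (v2r x)^T).
  by apply/eqP; rewrite -addr_eq0; apply/eqP/affine_zerosE.
have rkE : \rank R = \rank M.
  apply/eqP; rewrite eqn_leq; apply/andP; split.
    rewrite -[in leqRHS](hsubmxK M) -(row_mxKr (lsubmx M) R).
    have -> : rsubmx (row_mx (lsubmx M) R) = M *m col_mx 0 1%:M.
      by rewrite row_mxKr -[M in RHS]hsubmxK mul_row_col mulmx0 add0r mulmx1.
    by rewrite hsubmxK mxrankM_maxl.
  rewrite -{1}[M]hsubmxK -/R.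
  have -> : row_mx (lsubmx M) R = R *m row_mx (- (v2r x)^T) 1%:M.
    by rewrite mul_mx_row mulmx1 xE mulmxN.
  exact: mxrankM_maxl.
rewrite (@affine_dimE _ _ _ x (@mx2vs F V _ (kermx R^T))).
  by rewrite /dimv mx2vsK mxrank_ker mxrank_tr rkE.
apply/seteqP; split=> v /=.
  move=> /affine_zerosE; rewrite xE -/R => /eqP; rewrite addrC subr_eq0 => /eqP vE.
  rewrite memvE /subsetv !mx2vsK; apply/sub_kermxP/trmx_inj.
  by rewrite trmx_mul trmxK [v2r _]raddfB [(_ - _)^T]raddfB mulmxBr vE subrr trmx0.
rewrite memvE /subsetv !mx2vsK => /sub_kermxP/(congr1 trmx).
rewrite trmx_mul trmxK trmx0 [v2r _]raddfB [(_ - _)^T]raddfB mulmxBr.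
move=> /eqP; rewrite subr_eq0 => /eqP vE.
by apply/affine_zerosE; rewrite xE -/R vE addNr.
Qed.

Lemma affine_hyperplane_zeros (H : set V) : affine_hyperplane H ->
  exists w : 'rV[F]_(1 + d), H = affine_zeros w.
Proof.
case=> f [b [_ ->]].
exists (row_mx (- b%:M) (\row_j f (r2v (delta_mx 0 j)))).
have fE v : f v = ((\row_j f (r2v (delta_mx 0 j))) *m (v2r v)^T) 0 0.
  rewrite -[in LHS](v2rK v) [in LHS](row_sum_delta (v2r v)) !linear_sum mxE; apply: eq_bigr => j _.
  by rewrite !linearZ !mxE mulrC.
apply/seteqP; split=> v /=; rewrite affine_zerosE row_mxKl row_mxKr.
  by move=> fv; rewrite [X in _ + X]mx11_scalar -fE fv addNr.
move=> /eqP; rewrite addrC subr_eq0 => /eqP E.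
by rewrite fE E mxE eqxx.
Qed.

(** Otherwise [f] would be constant, equal to [f 0 = 0]. *)
Lemma affine_hyperplane_proper (H : set V) : affine_hyperplane H -> H <> setT.
Proof.
case=> f [b [f0 ->]] E.
have fb v : f v = b by have : [set v | f v = b] v by rewrite E.
case/eqP: f0; apply/lfunP => v; rewrite lfunE /= fb.
by rewrite -(fb 0) linear0.
Qed.

Lemma affine_zeros_adjoin (T : eqType) (w : T -> 'rV[F]_(1 + d)) (s : seq T) v :
  affine_zeros (adjoin 0 [seq w x | x <- s]) v <->
  forall x, x \in s -> affine_zeros (w x) v.
Proof.
split=> [vs x xs|vs]; last first.
  by apply/adjoin_subP; split=> [|_ /mapP[x /vs xv ->]//]; rewrite sub0mx.
by apply: affine_zerosS vs; apply: mem_adjoin; apply: map_f.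
Qed.

End Homogenization.

(** * The semilattice of flats *)

Section PosetRank.
Context {d : Order.disp_t} {P : finPOrderType d}.
Implicit Types (x y z : P) (C : {set P}).

(** A strictly monotone [f] is injective on a chain below [x], with values from 0 to [f x]. *)
Lemma poset_rank_leq (f : P -> nat) : {homo f : y z / (y < z)%O >-> (y < z)%N} ->
  forall x, (poset_rank x <= f x)%N.
Proof.
move=> fmono x; apply/bigmax_leqP => C /andP[/forall_inP chC /fintype.subsetP Cx].
have fx y : y \in C -> (f y < (f x).+1)%N.
  move=> /Cx; rewrite inE ltnS le_eqVlt => /predU1P[->//|/fmono]; exact: ltnW.
have inj : {in C &, injective (fun y => inord (f y) : 'I_(f x).+1)}.
  move=> y z yC zC /(congr1 val); rewrite /= !inordK ?fx // => fyz.
  have /forall_inP/(_ z zC) := chC y yC.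
  by case: comparableP => // /fmono; rewrite fyz ltnn.
have := max_card (mem ((fun y => inord (f y) : 'I_(f x).+1) @: C)).
by rewrite card_in_imset // card_ord; case: #|C|.
Qed.

Lemma poset_rank_chain x :
  exists C, [/\ chain C, C \subset [pred z | (z <= x)%O] & #|C| = (poset_rank x).+1].
Proof.
have [C /andP[chC Cx] rC] : {C : {set P} |
    chain C && (C \subset [pred z | (z <= x)%O]) & poset_rank x = #|C|.-1}.
  apply: eq_bigmax_cond; apply/card_gt0P; exists finset.set0.
  apply/andP; split; last by apply/fintype.subsetP => y; rewrite inE.
  by apply/forall_inP => y; rewrite inE.
have [C0|[y yC]] := finset.set_0Vmem C; last first.
  by exists C; split=> //; rewrite rC prednK //; apply/card_gt0P; exists y.
(* The empty chain can attain the maximum when the rank is 0, since [0.-1 = 0]; the singleton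
   replaces it. *)
exists [set x]; rewrite rC C0 cards0 cards1; split=> //.
  apply/forall_inP => y /finset.set1P->; apply/forall_inP => z /finset.set1P->.
  exact: comparablexx.
by apply/fintype.subsetP => y; rewrite !inE => /eqP->.
Qed.

(** A longest chain below [x] can be extended by [y]. *)
Lemma poset_rank_lt x y : (x < y)%O -> (poset_rank x < poset_rank y)%N.
Proof.
move=> xy; have [C [/forall_inP chC /fintype.subsetP Cx cC]] := poset_rank_chain x.
have Cy z : z \in C -> (z < y)%O by move=> /Cx; rewrite inE => /le_lt_trans; apply.
have yC : y \notin C by apply/negP => /Cy; rewrite ltxx.
have -> : (poset_rank x).+1 = #|y |: C|.-1 by rewrite cardsU1 yC cC.
apply: (leq_bigmax_cond (F := fun D : {set P} => #|D|.-1)); apply/andP; split.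
  apply/forall_inP => z /finset.setU1P zC; apply/forall_inP => t /finset.setU1P tC.
  case: zC tC => [->|zC] [->|tC]; first exact: comparablexx.
  - by apply: ge_comparable; apply/ltW/Cy.
  - by apply: le_comparable; apply/ltW/Cy.
  - by have /forall_inP := chC z zC; apply.
by apply/fintype.subsetP => z /finset.setU1P[->|/Cy/ltW]; rewrite inE.
Qed.

End PosetRank.

(* Exchange extends a family whose span avoids e until its span, joined with e,
   is everything. *)
Lemma central_basis (F : fieldType) (N : nat) (T : eqType) (e : 'rV[F]_N)
    (w : T -> 'rV[F]_N) (U : 'M[F]_N) (s : seq T) : ~~ (e <= U)%MS ->
  exists t : seq T, [/\ {subset t <= s}, ~~ (e <= adjoin U [seq w x | x <- t])%MS &
    (adjoin U [seq w x | x <- s] <= adjoin U [seq w x | x <- t] + e)%MS].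
Proof.
move=> eU; elim: s => [|x s [t [ts et st]]]; first by exists [::]; rewrite addsmxSl.
have [xt|xt] := boolP (w x <= adjoin U [seq w x | x <- t] + e)%MS.
  exists t; split=> //; last by rewrite addsmx_sub st.
  by move=> y /ts ys; rewrite inE ys orbT.
exists (x :: t); split.
- by move=> y; rewrite !inE => /predU1P[->|/ts ->]; rewrite ?eqxx ?orbT.
- by apply: contra xt; apply: submx_exchange.
rewrite /= addsmx_sub; apply/andP; split.
  by apply: submx_trans st _; apply: addsmxS => //; apply: addsmxSl.
by apply: submx_trans (addsmxSl _ _); apply: addsmxSr.
Qed.

Section Flats.
Local Open Scope classical_set_scope.
Context {F : fieldType} {V : vectType F} (A : {fset set V}).
Context (w : set V -> 'rV[F]_(1 + dim V)).
Context (wP : forall H, H \in A -> H = affine_zeros (w H)).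
Context (A_proper : forall H, H \in A -> H <> setT).
Implicit Types (B : {fset set V}) (X Y : Lposet A).

Let d := dim V.
Let e := @infinity_covector F V.
Let covector_span (B : {fset set V}) := adjoin 0 [seq w H | H <- B].
Let inter (B : {fset set V}) : set V := \bigcap_(H in [set` B]) H.

Lemma inter_zeros B : (B `<=` A)%fset -> inter B = affine_zeros (covector_span B).
Proof.
move=> /fsubsetP BA; apply/seteqP; split=> v /= vB.
  by apply/affine_zeros_adjoin => H HB; rewrite -wP; [apply: vB | apply: BA].
by move=> H HB; rewrite (wP (BA _ HB)); move/affine_zeros_adjoin: vB; apply.
Qed.

Lemma central_inter B : (B `<=` A)%fset ->
  inter B !=set0 <-> ~~ (e <= covector_span B)%MS.
Proof. by move=> BA; rewrite inter_zeros // affine_zeros_neq0. Qed.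

Lemma rank_central (U : 'M[F]_(1 + d)) : ~~ (e <= U)%MS -> (\rank U <= d)%N.
Proof. by move=> eU; rewrite -ltnS -(mxrank_adjoin eU) rank_leq_col. Qed.

Lemma flat_inter B : (B `<=` A)%fset -> inter B !=set0 -> inter B \in flats A.
Proof. by move=> BA B0; apply/flatsP; exists B. Qed.

Lemma val_flat X : exists B,
  [/\ (B `<=` A)%fset, val X = inter B & ~~ (e <= covector_span B)%MS].
Proof.
have /flatsP[B [BA XE X0]] := valP X.
by exists B; split=> //; apply/central_inter; rewrite // /inter -XE.
Qed.

Definition flat_corank X := (d - affine_dim (val X))%N.

Lemma flat_corankE X B : (B `<=` A)%fset -> val X = inter B ->
  flat_corank X = \rank (covector_span B).
Proof.
move=> BA XE; have X0 : inter B !=set0 by rewrite -XE; case/flatsP: (valP X) => ? [].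
rewrite /flat_corank XE inter_zeros // affine_dim_zeros -?inter_zeros // subKn //.
exact/rank_central/central_inter.
Qed.

Lemma flat_corank_lt : {homo flat_corank : X Y / (X < Y)%O >-> (X < Y)%N}.
Proof.
move=> X Y; rewrite lt_neqAle => /andP[neXY /asboolP YX].
have [B [BA XE _]] := val_flat X; have [C [CA YE _]] := val_flat Y.
have BCA : (B `|` C `<=` A)%fset by rewrite fsubUset BA.
(* The spans of [B] and [C] may be incomparable, but the union still cuts out [Y] and its span
   contains that of [B]. Equal ranks would then force equal flats. *)
have YE' : val Y = inter (B `|` C)%fset.
  apply/seteqP; split=> v.
    move=> Yv H; rewrite /= in_fsetU => /orP[HB|HC].
      by have := YX v Yv; rewrite XE; apply.
    by move: Yv; rewrite YE; apply.
  by move=> BCv; rewrite YE => H HC; apply: BCv; rewrite /= in_fsetU HC orbT.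
rewrite (flat_corankE BA XE) (flat_corankE BCA YE').
have sub : (covector_span B <= covector_span (B `|` C)%fset)%MS.
  apply/adjoin_subP; split; first by rewrite sub0mx.
  by move=> _ /mapP[H HB ->]; apply/mem_adjoin/map_f; rewrite in_fsetU HB.
rewrite ltn_neqAle mxrankS // andbT (mxrank_leqif_sup sub).
apply: contra neXY => sub'; apply/eqP/val_inj/seteqP; split=> //.
by rewrite XE YE' !inter_zeros //; apply: affine_zerosS.
Qed.

(** Hyperplanes are removed one at a time. If the flat does not change, neither does the rank of the
    span; otherwise the poset rank drops strictly and the rank of the span by at most one. *)
Lemma rank_le_poset_rank B X : (B `<=` A)%fset -> val X = inter B ->
  (\rank (covector_span B) <= poset_rank X)%N.
Proof.
have [k] := ubnP #|` B|%fset; elim: k B X => // k IHk B X ltk BA XE.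
have [B0|[H HB]] := fset_0Vmem B.
  by rewrite B0 /covector_span /= mxrank0.
set C := (B `\ H)%fset.
have CA : (C `<=` A)%fset by apply: fsubset_trans BA; apply: fsubD1set.
have XC : val X `<=` inter C.
  by rewrite XE => v Bv K; rewrite /= in_fsetD1 => /andP[_]; apply: Bv.
have C0 : inter C !=set0.
  by have /flatsP[_ [_ _ [v Xv]]] := valP X; exists v; apply: XC.
pose Y : Lposet A := [` flat_inter CA C0]%fset.
have YE : val Y = inter C by [].
have YX : (Y <= X)%O by apply/asboolP; rewrite YE.
have IH : (\rank (covector_span C) <= poset_rank Y)%N.
  apply: IHk => //; rewrite -ltnS; apply: leq_trans ltk.
  by rewrite ltnS [#|` B|%fset](cardfsD1 H) HB.
have [E|neYX] := eqVneq Y X.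
  by rewrite -(flat_corankE BA XE) -E (flat_corankE CA YE).
have lt : (Y < X)%O by rewrite lt_neqAle neYX.
apply: leq_trans (poset_rank_lt lt); rewrite -ltnS in IH; apply: leq_trans IH.
rewrite /covector_span -(fsetD1K HB) (adjoin_fset1U w 0 H C).
apply: leq_trans (mxrank_adds_leqif _ _) _.
by rewrite -[leqRHS]addn1 leq_add2l rank_leq_row.
Qed.

Lemma arrangement_rankE : arrangement_rank A = affine_rank e 0 [seq w H | H <- A].
Proof.
have e0 : ~~ (e <= (0 : 'M_(1 + d)))%MS by exact: infinity_covector0.
have e_neq0 : e != 0 by apply: contraNneq e0 => ->; rewrite sub0mx.
apply/eqP; rewrite eqn_leq; apply/andP; split.
  apply/bigmax_leqP => X _; have [B [BA XE eB]] := val_flat X.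
  apply: leq_trans (poset_rank_leq flat_corank_lt X) _.
  rewrite (flat_corankE BA XE) -ltnS affine_rankE // -(mxrank_adjoin eB).
  apply: mxrankS; apply: addsmxS => //; apply/adjoin_subP.
  split; first exact: sub_adjoin.
  by move=> _ /mapP[H HB ->]; apply/mem_adjoin/map_f/(fsubsetP BA).
(* For the lower bound, a central subfamily whose span together with [e] is everything yields a flat
   of sufficient rank. *)
have [t [tA et At]] := central_basis w A e0.
pose B := [fset H in t]%fset.
have BA : (B `<=` A)%fset by apply/fsubsetP => H; rewrite inE => /tA.
have Bt : (covector_span B :=: adjoin 0 [seq w H | H <- t])%MS.
  apply: eq_adjoin => h; apply/mapP/mapP => -[H HB ->]; exists H => //.
    by rewrite inE in HB.
  by rewrite inE.
have eB : ~~ (e <= covector_span B)%MS by rewrite Bt.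
pose X : Lposet A := [` flat_inter BA (proj2 (central_inter BA) eB)]%fset.
apply: leq_trans (leq_bigmax X).
apply: leq_trans (rank_le_poset_rank BA (erefl : val X = inter B)).
rewrite -ltnS affine_rankE // -(mxrank_adjoin eB); apply: mxrankS.
by rewrite addsmx_sub addsmxSr andbT; apply: submx_trans At _; apply: addsmxS; rewrite ?Bt.
Qed.

(** Summing the right-hand side over the flats below [X] collects all subfamilies of the hyperplanes
    containing [X]; the signs cancel unless there are no such hyperplanes, that is, unless [X] is
    the whole space. *)
Lemma mobius_flat X : mobius \bot%O X =
  \sum_(B <- fpowerset A | inter B == val X) (-1) ^+ #|` B|%fset.
Proof.
move: X; apply: mobius_unique => X.
rewrite (exchange_big_dep xpredT) //=.
pose AX := [fset H in A | `[< (val X `<=` H)%classic >]]%fset.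
have -> : (X == \bot%O) = (AX == fset0).
  apply/eqP/eqP => [XT|AX0].
    rewrite /AX XT; apply/fsetP => H; rewrite !inE; apply/negP => /andP[HA /asboolP TH].
    by apply: (A_proper HA); apply/seteqP; split.
  have [B [BA XE _]] := val_flat X; apply/val_inj; rewrite /= XE.
  apply/seteqP; split=> // v _ H HB.
  have : H \in AX.
    rewrite !inE (fsubsetP BA) //=; apply/asboolP; rewrite XE => u; exact.
  by rewrite AX0 inE.
rewrite -sum_sign_fpowerset.
have AXA : (AX `<=` A)%fset by apply/fsubsetP => H; rewrite !inE => /andP[].
have subE B : (B `<=` AX)%fset = (B `<=` A)%fset && `[< val X `<=` inter B >].
  apply/fsubsetP/andP => [BX|[/fsubsetP BA /asboolP XB] H HB].
    split; first by apply/fsubsetP => H /BX; apply: (fsubsetP AXA).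
    apply/asboolP => v Xv H HB; have := BX H HB; rewrite !inE => /andP[_ /asboolP].
    exact.
  by rewrite !inE BA //=; apply/asboolP => v /XB; apply.
have -> : \sum_(B <- fpowerset AX) (-1) ^+ #|` B|%fset =
    \sum_(B <- fpowerset A | `[< val X `<=` inter B >]) (-1) ^+ #|` B|%fset :> int.
  rewrite -[RHS]big_filter; apply: perm_big; apply: uniq_perm.
  - exact: fset_uniq.
  - exact: filter_uniq.
  - by move=> B; rewrite mem_filter !fpowersetE subE andbC.
rewrite [RHS]big_mkcond; apply: eq_big_seq => B; rewrite fpowersetE => BA.
case: asboolP => [XB|XB].
  have B0 : inter B !=set0.
    by case/flatsP: (valP X) => _ [_ _ [v Xv]]; exists v; apply: XB.
  rewrite (big_pred1 [` flat_inter BA B0]%fset) // => Y.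
  apply/andP/eqP => [[_ /eqP YE]|->]; first exact/val_inj.
  by split=> //; apply/asboolP.
by rewrite big_pred0 // => Y; apply/negP => /andP[/asboolP YX /eqP BY]; case: XB; rewrite BY.
Qed.

(** Whitney's theorem: after exchanging sums, each subfamily contributes at the one flat it cuts
    out, or nowhere if its intersection is empty. *)
Lemma charpoly_whitney :
  arrangement_charpoly A = whitney_poly e 0 [seq w H | H <- A].
Proof.
rewrite (@whitney_poly_sum _ _ _ _ _ _ _ A) //.
rewrite /arrangement_charpoly.
under eq_bigr do rewrite mobius_flat scaler_suml.
rewrite (exchange_big_dep xpredT) //=; apply: eq_big_seq => B.
rewrite fpowersetE => BA; rewrite /whitney_term -/e -/(covector_span B).
have [eB|eB] := ifPn.
  rewrite mulr0 big_pred0 // => X; apply/negP => /eqP BX.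
  have : inter B !=set0 by rewrite BX; case/flatsP: (valP X) => ? [].
  by move/(central_inter BA); rewrite eB.
pose X : Lposet A := [` flat_inter BA (proj2 (central_inter BA) eB)]%fset.
rewrite (big_pred1 X) => [|Y]; last by apply/eqP/eqP => [YE|->//]; apply/val_inj.
rewrite -mul_polyC rmorph_sign; congr (_ * 'X^_).
rewrite /= inter_zeros // affine_dim_zeros //; exact/affine_zeros_neq0.
Qed.

End Flats.

(** * Coefficients under the substitution of 1 - t, and the conclusion *)

Lemma coef_1subX_exp (R : comNzRingType) (m j : nat) :
  ((1 - 'X) ^+ m : {poly R})`_j = (-1) ^+ j * 'C(m, j)%:R.
Proof.
have -> : (1 - 'X) ^+ m = \poly_(i < m.+1) ((-1) ^+ i * 'C(m, i)%:R) :> {poly R}.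
  rewrite exprBn poly_def; apply: eq_bigr => i _.
  by rewrite expr1n mulr1 -mulrnAl -mul_polyC polyCM rmorph_sign polyC_natr mulr_natr.
rewrite coef_poly ltnS; case: leqP => // mj.
by rewrite bin_small // mulr0.
Qed.

(** Terms with [i > k] have degree below [r - k]; for the others,
    ['C(r - i, r - k) = 'C(r - i, k - i)] by symmetry. *)
Lemma coef_comp_1subX (a : nat -> int) (r k : nat) : (k <= r)%N ->
  ((\sum_(0 <= i < r.+1) ((-1) ^+ i * a i) *: 'X^(r - i)) \Po (1 - 'X))`_(r - k) =
  (-1) ^+ (r - k) * \sum_(0 <= i < k.+1) 'C(r - i, k - i)%:R * (-1) ^+ i * a i.
Proof.
move=> kr; rewrite raddf_sum coef_sum (big_cat_nat (n := k.+1)) //= addrC.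
rewrite big_nat_cond big1 ?add0r => [|i]; last first.
  rewrite andbT => /andP[ki ir]; rewrite comp_polyZ comp_Xn_poly coefZ coef_1subX_exp.
  by rewrite bin_small ?mulr0 // ltn_sub2l // (leq_trans ki).
rewrite mulr_sumr; apply: eq_big_nat => i /andP[_]; rewrite ltnS => ik.
rewrite comp_polyZ comp_Xn_poly coefZ coef_1subX_exp.
rewrite -(bin_sub (_ : (r - k <= r - i)%N)) ?leq_sub2l //.
have -> : (r - i - (r - k) = k - i)%N by rewrite -subnDA addnC subnDA subKn.
by rewrite mulrCA [_ * _%:R]mulrC -[in RHS]mulrA.
Qed.

Theorem corollary2p6 (F : fieldType) (V : vectType F) (n m r : nat)
    (A : {fset set V}) (a : nat -> int)
    (hn : \dim {:V} = n) (hA : is_arrangement A) (hm : #|` A|%fset = m)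
    (hr : r = arrangement_rank A)
    (hchi : arrangement_charpoly A =
       \sum_(0 <= i < r.+1) ((-1) ^+ i * a i) *: 'X^(n - i)) :
  forall k : nat, (k <= r)%N ->
    0 <= (-1) ^+ k *
         \sum_(0 <= i < k.+1) 'C(r - i, k - i)%:R * (-1) ^+ i * a i.
Proof.
move=> k kr; rewrite dimvf in hn.
have /choice[w wP] : forall H : set V,
    exists x : 'rV[F]_(1 + dim V), H \in A -> H = affine_zeros x.
  move=> H; have [/hA/affine_hyperplane_zeros[x xH]|_] := boolP (H \in A).
    by exists x.
  by exists 0.
have A_proper H : H \in A -> H <> setT by move/hA; apply: affine_hyperplane_proper.
have rE := arrangement_rankE wP; rewrite -hr in rE.
have rn : (r <= n)%N.
  by rewrite rE -hn /affine_rank -subn1 leq_subLR rank_leq_col.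
have e0 : ~~ (@infinity_covector F V <= (0 : 'M_(1 + dim V)))%MS.
  exact: infinity_covector0.
have [c c_ge0] := whitney_poly_sign [seq w H | H <- A] e0.
rewrite -rE mxrank0 subn0 -(charpoly_whitney wP A_proper) hchi hn.
set P := \sum_(0 <= i < r.+1) ((-1) ^+ i * a i) *: 'X^(r - i).
have -> : \sum_(0 <= i < r.+1) ((-1) ^+ i * a i) *: 'X^(n - i) = 'X^(n - r) * P.
  rewrite mulr_sumr; apply: eq_big_nat => i /andP[_]; rewrite ltnS => ir.
  by rewrite -scalerAr -exprD addnBA // subnK.
rewrite [_ ^+ r * _]mulrC -mulrA => /(mulfI (monic_neq0 (monicXn _ _))) PE.
(* Substituting [1 - 'X] is an involution, so it turns [PE] into an equality of [P \Po (1 - 'X)]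
   with [c] up to the sign [(-1) ^+ r]; the coefficients of degree [r - k] are compared. *)
have /(congr1 (fun p : {poly int} => (p \Po (1 - 'X))`_(r - k))) := PE.
rewrite coef_comp_1subX // comp_polyM -comp_polyA.
have -> : (1 - 'X) \Po (1 - 'X) = 'X :> {poly int}.
  by rewrite comp_polyB comp_polyX comp_polyC subKr.
rewrite comp_polyXr -(rmorph_sign polyC) comp_polyC coefCM => E.
have -> : (-1) ^+ k = (-1) ^+ r * (-1) ^+ (r - k) :> int.
  by rewrite -{1}(subnK kr) exprD mulrAC -expr2 sqrr_sign mul1r.
by rewrite -mulrA E mulrA -expr2 sqrr_sign mul1r.
Qed.
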